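(* Each of the seven graphs $$K_5,\quad \overline{3K_3},\quad 2K_3\oplus\overline{K_2},\quad 2\left(\overline{2K_2}\right)\oplus\overline{K_3},\quad \overline{2K_2}\oplus(K_1+K_2),\quad \left(\overline{2K_2}+K_3\right)\oplus\overline{K_2},\quad \overline{3K_2+K_1}$$ is a cograph minimal obstruction to arboricity $2$.
   Context: All graphs are finite and simple. $G+H$ denotes disjoint union, $nG$ the disjoint union of $n$ copies of $G$, $G\oplus H$ the join (the disjoint union plus all edges between $G$ and $H$), and $\overline{G}$ the complement. A cograph is a graph with no induced path $P_4$ on four vertices; equivalently, a graph obtainable from $K_1$ by repeatedly applying disjoint union and complement. A cograph minimal obstruction to arboricity $p$ is a cograph whose vertex set cannot be partitioned into $p$ (possibly empty) subsets each inducing a forest, but such that the vertex set of every proper induced subgraph can be so partitioned. *)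

(* Defs.v *)
From HB Require Import structures.
From mathcomp Require Import all_boot.
Set Implicit Arguments.
Unset Strict Implicit.
Unset Printing Implicit Defensive.

Record sgraph := SGraph {
  vertex :> finType;
  adj : rel vertex;
  adj_sym : symmetric adj;
  adj_irr : irreflexive adj
}.

Definition complete_adj (n : nat) : rel 'I_n := fun x y => x != y.

Lemma complete_adj_sym n : symmetric (@complete_adj n).
Proof. by move=> x y; rewrite /complete_adj eq_sym. Qed.

Lemma complete_adj_irr n : irreflexive (@complete_adj n).
Proof. by move=> x; rewrite /complete_adj eqxx. Qed.

Definition complete (n : nat) : sgraph :=
  SGraph (@complete_adj_sym n) (@complete_adj_irr n).

Definition path_adj (n : nat) : rel 'I_n :=
  fun x y => (x.+1 == y :> nat) || (y.+1 == x :> nat).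

Lemma path_adj_sym n : symmetric (@path_adj n).
Proof. by move=> x y; rewrite /path_adj orbC. Qed.

Lemma path_adj_irr n : irreflexive (@path_adj n).
Proof. by move=> x; rewrite /path_adj orbb eqn_leq ltnn. Qed.

Definition path_graph (n : nat) : sgraph :=
  SGraph (@path_adj_sym n) (@path_adj_irr n).

Definition compl_adj (G : sgraph) : rel G := fun x y => (x != y) && ~~ adj x y.

Lemma compl_adj_sym G : symmetric (@compl_adj G).
Proof. by move=> x y; rewrite /compl_adj eq_sym adj_sym. Qed.

Lemma compl_adj_irr G : irreflexive (@compl_adj G).
Proof. by move=> x; rewrite /compl_adj eqxx. Qed.

Definition compl (G : sgraph) : sgraph :=
  SGraph (@compl_adj_sym G) (@compl_adj_irr G).

Definition dunion_adj (G H : sgraph) : rel (G + H)%type := fun u v =>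
  match u, v with
  | inl x, inl y => adj x y
  | inr x, inr y => adj x y
  | _, _ => false
  end.

Lemma dunion_adj_sym G H : symmetric (@dunion_adj G H).
Proof. by case=> x [] y //=; rewrite adj_sym. Qed.

Lemma dunion_adj_irr G H : irreflexive (@dunion_adj G H).
Proof. by case=> x /=; rewrite adj_irr. Qed.

Definition dunion (G H : sgraph) : sgraph :=
  SGraph (@dunion_adj_sym G H) (@dunion_adj_irr G H).

Definition join_adj (G H : sgraph) : rel (G + H)%type := fun u v =>
  match u, v with
  | inl x, inl y => adj x y
  | inr x, inr y => adj x y
  | _, _ => true
  end.

Lemma join_adj_sym G H : symmetric (@join_adj G H).
Proof. by case=> x [] y //=; rewrite adj_sym. Qed.

Lemma join_adj_irr G H : irreflexive (@join_adj G H).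
Proof. by case=> x /=; rewrite adj_irr. Qed.

Definition join (G H : sgraph) : sgraph :=
  SGraph (@join_adj_sym G H) (@join_adj_irr G H).

Definition copies_adj (n : nat) (G : sgraph) : rel ('I_n * G)%type :=
  fun u v => (u.1 == v.1) && adj u.2 v.2.

Lemma copies_adj_sym n G : symmetric (@copies_adj n G).
Proof. by move=> u v; rewrite /copies_adj eq_sym adj_sym. Qed.

Lemma copies_adj_irr n G : irreflexive (@copies_adj n G).
Proof. by move=> u; rewrite /copies_adj adj_irr andbF. Qed.

Definition copies (n : nat) (G : sgraph) : sgraph :=
  SGraph (@copies_adj_sym n G) (@copies_adj_irr n G).

Definition induced_adj (G : sgraph) (A : {set G}) : rel {x : G | x \in A} :=
  fun x y => adj (val x) (val y).

Lemma induced_adj_sym G A : symmetric (@induced_adj G A).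
Proof. by move=> x y; rewrite /induced_adj adj_sym. Qed.

Lemma induced_adj_irr G A : irreflexive (@induced_adj G A).
Proof. by move=> x; rewrite /induced_adj adj_irr. Qed.

Definition induced (G : sgraph) (A : {set G}) : sgraph :=
  SGraph (@induced_adj_sym G A) (@induced_adj_irr G A).

Definition induced_embedding (H G : sgraph) (f : H -> G) : Prop :=
  injective f /\ forall x y : H, adj (f x) (f y) = adj x y.

Definition cograph (G : sgraph) : Prop :=
  ~ exists f : path_graph 4 -> G, induced_embedding f.

(* The size condition is needed because [ucycle] also accepts the empty
   sequence and an edge traversed back and forth. *)
Definition forest (G : sgraph) : Prop :=
  forall c : seq G, 2 < size c -> ~ ucycle (@adj G) c.

(* A partition into p possibly empty subsets is encoded by the map sending
   each vertex to the index of its part. *)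
Definition forest_partitionable (p : nat) (G : sgraph) : Prop :=
  exists f : {ffun G -> 'I_p},
    forall i : 'I_p, forest (induced [set x | f x == i]).

Definition cograph_min_obstruction (p : nat) (G : sgraph) : Prop :=
  [/\ cograph G,
      ~ forest_partitionable p G
    & forall A : {set G}, A \proper [set: G] ->
        forest_partitionable p (induced A)].

(* Main.v *)
(** In a graph without induced [P_4], every cycle of length at least 4 yields a
    triangle or a 4-cycle on its first four vertices, so such a graph is a
    forest iff it has no cycle of length 3 or 4. Whether a given cograph splits
    into two forests is then a 2-colouring problem on the hypergraph of its
    short cycles, small enough here to be settled by exhaustive search, for
    each graph and for each of its vertex-deleted subgraphs. *)
Require Import Defs.
From mathcomp Require Import all_boot.
Set Implicit Arguments.
Unset Strict Implicit.
Unset Printing Implicit Defensive.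

(** * Forests and short cycles in [P_4]-free graphs *)

(* Distinctness is not required: for a walk x y z w with a repeated vertex one
   of the three adjacencies holds anyway. *)
Definition P4_free (G : sgraph) : Prop :=
  forall x y z w : G, adj x y -> adj y z -> adj z w ->
    [|| adj x z, adj y w | adj x w].

(** The image of an induced path is a three-edge walk with none of the three further adjacencies. *)
Lemma P4_free_cograph (G : sgraph) : P4_free G -> cograph G.
Proof.
move=> P4G [f [_ fadj]].
have := P4G (f (inord 0)) (f (inord 1)) (f (inord 2)) (f (inord 3)).
by rewrite !fadj /= /path_adj !inordK //= => /(_ isT isT isT).
Qed.

Lemma P4_free_induced (G : sgraph) (A : {set G}) :
  P4_free G -> P4_free (induced A).
Proof. by move=> P4G x y z w; apply: P4G. Qed.

Definition short_ucycle (G : sgraph) (c : seq G) : bool :=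
  (size c \in [:: 3; 4]) && ucycleb (@adj G) c.

Lemma short_ucycle_map (G H : sgraph) (h : H -> G) (c : seq H) :
  induced_embedding h -> short_ucycle (map h c) = short_ucycle c.
Proof.
move=> [h_inj h_adj]; rewrite /short_ucycle /ucycleb size_map map_inj_uniq //.
congr (_ && (_ && _)); case: c => //= x p; rewrite -map_rcons path_map.
by apply: eq_path => y z /=; rewrite h_adj.
Qed.

Lemma induced_embedding_val (G : sgraph) (A : {set G}) :
  induced_embedding (val : induced A -> G).
Proof. by split; [apply: val_inj | ]. Qed.

Lemma P4_free_forest (G : sgraph) :
  P4_free G -> (forall c : seq G, ~~ short_ucycle c) -> forest G.
Proof.
move=> P4G noc c + /andP[cyc uc].
case: c cyc uc => [|x [|y [|z [|w c]]]] // cyc uc _.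
  by have := noc [:: x; y; z]; rewrite /short_ucycle /ucycleb cyc uc.
have /and4P[xy yz zw _] : [&& adj x y, adj y z, adj z w & true].
  by move: cyc => /= /and4P[-> -> ->].
have xw : uniq [:: x; y; z; w].
  exact: (subseq_uniq (prefix_subseq [:: x; y; z; w] c)).
have yzw : uniq [:: y; z; w] by case/andP: xw.
have xyz : uniq [:: x; y; z].
  exact: (subseq_uniq (prefix_subseq [:: x; y; z] [:: w])).
(* The edge [x z] or [y w] closes a triangle, the edge [x w] a 4-cycle. *)
have /or3P[xz|yw|xw'] := P4G _ _ _ _ xy yz zw.
- have := noc [:: x; y; z].
  by rewrite /short_ucycle /ucycleb xyz /= xy yz adj_sym xz.
- have := noc [:: y; z; w].
  by rewrite /short_ucycle /ucycleb yzw /= yz zw adj_sym yw.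
- have := noc [:: x; y; z; w].
  by rewrite /short_ucycle /ucycleb xw /= xy yz zw adj_sym xw'.
Qed.

Lemma forest_induced_short (G : sgraph) (A : {set G}) (c : seq G) :
  forest (induced A) -> {subset c <= A} -> ~~ short_ucycle c.
Proof.
move=> forA cA; apply/negP => cyc.
(* Since [c] lies in [A], [insub] drops no vertex and [c'] is a copy of [c] in the induced
   subgraph. *)
pose c' : seq (induced A) := pmap insub c.
have cE : map val c' = c.
  rewrite pmap_filter; last exact: insubK.
  by apply/all_filterP/allP => x /cA xA; rewrite insubT.
move: cyc; rewrite -cE (short_ucycle_map _ (induced_embedding_val A)).
case/andP=> sz /andP[cyc uc]; apply: (forA c'); last by rewrite /ucycle cyc.
by move: sz; rewrite !inE => /orP[] /eqP ->.
Qed.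

Lemma P4_free_forest_induced (G : sgraph) (A : {set G}) :
  P4_free G -> (forall c : seq G, {subset c <= A} -> ~~ short_ucycle c) ->
  forest (induced A).
Proof.
move=> P4G noc; apply: P4_free_forest; first exact: P4_free_induced.
move=> c; rewrite -(short_ucycle_map _ (induced_embedding_val A)).
by apply: noc => _ /mapP[x _ ->]; apply: valP.
Qed.

(** * Exhaustive search for a two-colouring of a hypergraph *)

(* Whether every red/blue colouring of the vertices in [s] makes some member of
   [R] entirely red or some member of [B] entirely blue. Colouring a vertex red
   shrinks the members of [R] containing it and discards those of [B].
   Conditionals replace [&&] so that call-by-value evaluation prunes the
   search. *)
Fixpoint uncolorable (T : eqType) (s : seq T) (R B : seq (seq T)) : bool :=
  if ([::] \in R) || ([::] \in B) then true else
  if s is x :: s' then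
    if uncolorable s' (map (filter (predC1 x)) R) [seq c <- B | x \notin c]
    then uncolorable s' [seq c <- R | x \notin c] (map (filter (predC1 x)) B)
    else false
  else false.

(** Here [f] marks the red vertices. The branch that agrees with [f] on the head of [s] yields a
    monochromatic member, which stays monochromatic when the head is put back. An empty member is
    vacuously monochromatic. *)
Lemma uncolorable_sound (T : eqType) (s : seq T) (R B : seq (seq T))
    (f : pred T) :
  uncolorable s R B -> has (all f) R || has (all (predC f)) B.
Proof.
have shrink (g : pred T) x L : g x ->
    has (all g) (map (filter (predC1 x)) L) -> has (all g) L.
  move=> gx /hasP[_ /mapP[c cL ->] /allP gc]; apply/hasP; exists c => //.
  apply/allP => y yc; case: (eqVneq y x) => [->//|yx].
  by apply: gc; rewrite mem_filter /= yx.
have discard (g : pred T) x L :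
    has (all g) [seq c <- L | x \notin c] -> has (all g) L.
  by rewrite has_filter -filter_predI -has_filter; apply: sub_has => c /andP[].
have nil_mono (R' B' : seq (seq T)) : ([::] \in R') || ([::] \in B') ->
    has (all f) R' || has (all (predC f)) B'.
  by case/orP=> nilL; apply/orP; [left|right]; apply/hasP; exists [::].
elim: s R B => [|x s IHs] R B /=; first by case: ifP => // /nil_mono.
case: ifP => [/nil_mono//|_].
case: ifP => // /IHs red /IHs blue; apply/orP; case: (boolP (f x)) => fx.
  by case/orP: red => [/(shrink _ _ _ fx)|/discard]; [left|right].
by case/orP: blue => [/discard|/(shrink (predC f) _ _ fx)]; [left|right].
Qed.

(** A branch on which the search fails spells out a colouring. *)
Lemma uncolorable_complete (T : eqType) (s : seq T) (R B : seq (seq T)) :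
  {in R ++ B, forall c, {subset c <= s}} -> ~~ uncolorable s R B ->
  exists f : pred T, ~~ has (all f) R && ~~ has (all (predC f)) B.
Proof.
elim: s R B => [|x s IHs] R B sub /=; case: ifP => // /norP[R0 B0].
  (* With no vertices left every member would be empty, yet none is, so both lists are empty and any
     colouring works. *)
  move=> _; exists predT; rewrite -negb_or.
  apply/norP; split; apply/hasPn => c cL.
  - have := sub c; rewrite mem_cat cL; case: c cL => [|y c] cL.
      by rewrite cL in R0.
    by move=> /(_ isT y (mem_head _ _)).
  - have := sub c; rewrite mem_cat cL orbT; case: c cL => [|y c] cL.
      by rewrite cL in B0.
    by move=> /(_ isT y (mem_head _ _)).
have shrink (g g' : pred T) L : (forall y, y != x -> g y = g' y) ->
    ~~ has (all g) (map (filter (predC1 x)) L) -> ~~ has (all g') L.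
  move=> eqg /hasPn noc; apply/hasPn => c cL; apply/allP => g'c.
  have /allP[] := noc _ (map_f _ cL).
  by move=> y; rewrite mem_filter => /andP[yx yc]; rewrite eqg ?g'c.
have discard (g g' : pred T) L : (forall y, y != x -> g y = g' y) -> ~~ g' x ->
    ~~ has (all g) [seq c <- L | x \notin c] -> ~~ has (all g') L.
  move=> eqg g'x /hasPn noc; apply/hasPn => c cL; apply/allP => g'c.
  have xc : x \notin c by apply: contra g'x => /g'c.
  have /allP[] : ~~ all g c by apply: noc; rewrite mem_filter xc.
  by move=> y yc; rewrite eqg ?g'c //; apply: contraNneq xc => <-.
have sub_shrink L c : {subset L <= R ++ B} ->
    c \in map (filter (predC1 x)) L -> {subset c <= s}.
  move=> LRB /mapP[d /LRB dL ->] y; rewrite mem_filter => /andP[/negPf yx yd].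
  by have := sub d dL y yd; rewrite inE yx.
have sub_discard L c : {subset L <= R ++ B} ->
    c \in [seq c <- L | x \notin c] -> {subset c <= s}.
  move=> LRB; rewrite mem_filter => /andP[xc /LRB cL] y yc.
  have := sub c cL y yc; rewrite inE => /predU1P[yx|//].
  by rewrite -yx yc in xc.
have RRB : {subset R <= R ++ B} by move=> c; rewrite mem_cat => ->.
have BRB : {subset B <= R ++ B} by move=> c; rewrite mem_cat orbC => ->.
case: ifP => [_|/negbT un _].
  move=> /IHs[c|f /andP[fR fB]].
    by rewrite mem_cat => /orP[]; [apply: sub_discard|apply: sub_shrink].
  (* The failing branch colours [x] blue. *)
  exists (fun y => (y != x) && f y); apply/andP; split.
    by apply: discard fR => [y ->|] //=; rewrite eqxx.
  by apply: shrink fB => y /= ->.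
have [c|f /andP[fR fB]] := IHs _ _ _ un.
  by rewrite mem_cat => /orP[]; [apply: sub_shrink|apply: sub_discard].
(* The failing branch colours [x] red. *)
exists (fun y => (y == x) || f y); apply/andP; split.
  by apply: shrink fR => y /= /negPf ->.
by apply: discard fB => [y /= /negPf ->|] //=; rewrite eqxx.
Qed.

(** * Deciding minimal obstruction over an explicit vertex list *)

Definition covers (G : sgraph) (s : seq G) : Prop := forall x, x \in s.

Section Decide.
Variables (G : sgraph) (s : seq G).
Hypothesis s_full : covers s.

Fixpoint walks (n : nat) (x : G) : seq (seq G) :=
  if n is m.+1 then
    [seq y :: p | y <- [seq y <- s | adj x y], p <- walks m y]
  else [:: [::]].

Lemma mem_walks (x : G) (p : seq G) :
  path (@adj G) x p -> p \in walks (size p) x.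
Proof.
elim: p x => [|y p IHp] x //= /andP[xy yp].
by apply/allpairsPdep; exists y, p; rewrite mem_filter xy s_full IHp.
Qed.

(** Listing the vertices of a cycle in the order of [s] lets [undup] merge all cycles on the same
    vertices into one hyperedge. A cycle of length 3 or 4 is its start followed by a walk of 2 or 3
    vertices. *)
Definition short_ucycle_supports : seq (seq G) :=
  undup [seq [seq y <- s | y \in c] |
    c <- [seq x :: p | x <- s, p <- walks 2 x ++ walks 3 x] &
    ucycleb (@adj G) c].

Lemma short_ucycle_support (c : seq G) :
  short_ucycle c -> [seq y <- s | y \in c] \in short_ucycle_supports.
Proof.
case/andP=> sz uc; rewrite mem_undup; apply/map_f; rewrite mem_filter uc /=.
case: c sz uc => [|x p] // sz /andP[cyc _].
apply/allpairsPdep; exists x, p; split=> //.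
have : p \in walks (size p) x.
  by apply: mem_walks; move: cyc; rewrite /= rcons_path => /andP[].
by rewrite mem_cat; move: sz; rewrite !inE => /orP[] /eqP[->] ->; rewrite ?orbT.
Qed.

Lemma short_ucycle_supportsP (d : seq G) :
  d \in short_ucycle_supports -> exists2 c, short_ucycle c & d =i c.
Proof.
rewrite mem_undup => /mapP[c cL ->]; exists c; last first.
  by move=> x; rewrite mem_filter s_full andbT.
move: cL; rewrite mem_filter /short_ucycle => /andP[->].
case/allpairsPdep=> x [p [_ + ->]].
have sz n y q : q \in walks n y -> size q = n.
  elim: n y q => [|n IHn] y q /=; first by rewrite inE => /eqP ->.
  by case/allpairsPdep=> z [q' [_ /IHn sq' ->]] /=; rewrite sq'.
by rewrite mem_cat => /orP[] /sz /= ->.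
Qed.

Definition P4_freeb : bool :=
  all (fun x => all (fun p =>
    if p is [:: y; z; w] then [|| adj x z, adj y w | adj x w] else true)
    (walks 3 x)) s.

Lemma P4_freeP : P4_freeb -> P4_free G.
Proof.
move=> /allP chk x y z w xy yz zw.
have /allP/(_ [:: y; z; w]) := chk x (s_full x); apply.
by apply: (@mem_walks x [:: y; z; w]); rewrite /= xy yz zw.
Qed.

(** A proper induced subgraph misses some vertex [v], and a colouring found after deleting [v]
    restricts to it, so single deletions suffice. *)
Definition min_obstructionb : bool :=
  let L := short_ucycle_supports in
  [&& P4_freeb, uncolorable s L L &
    all (fun v => let Lv := [seq c <- L | v \notin c] in
                  ~~ uncolorable s Lv Lv) s].

Lemma min_obstructionP : min_obstructionb -> cograph_min_obstruction 2 G.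
Proof.
case/and3P=> /P4_freeP P4G unc /allP col; split; first exact: P4_free_cograph.
  case=> f forf.
  have no_mono i d :
      d \in short_ucycle_supports -> ~~ all (fun x => f x == i) d.
    case/short_ucycle_supportsP=> c cyc eqdc; apply/allP => fd.
    have := forest_induced_short (forf i) (c := c); rewrite cyc => H.
    by apply/notF/H => x; rewrite -eqdc inE => /fd.
  have /orP[] := uncolorable_sound (fun x => f x == ord0) unc.
    by case/hasP=> d dL; apply/negP/no_mono.
  case/hasP=> d dL; apply/negP.
  (* In ['I_2] a vertex outside part [ord0] is in part [ord_max], so blue is the second part. *)
  rewrite (eq_all (a2 := fun x => f x == ord_max)); first exact: no_mono.
  by move=> x /=; case: (f x) => [[|[|m]] lt_m].
move=> A /properP[_ [v _ vA]].
have [c _ x _|g /andP[/hasPn gL /hasPn gL']] :=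
  uncolorable_complete _ (col v (s_full v)); first exact: s_full.
exists [ffun x => if g (val x) then ord0 else ord_max] => i.
apply: P4_free_forest_induced; first exact: P4_free_induced.
move=> c fc; apply/negP => cyc.
have {}cyc : short_ucycle (map val c).
  by rewrite (short_ucycle_map _ (induced_embedding_val A)).
have dL : [seq y <- s | y \in map val c] \in
    [seq d <- short_ucycle_supports | v \notin d].
  rewrite mem_filter short_ucycle_support // andbT mem_filter s_full andbT.
  by apply: contra vA => /mapP[x _ ->]; apply: valP.
(* The cycle has a blue vertex [x] and a red vertex [y], although [fc] puts both in part [i]. *)
have [/allPn[x xc gx] /allPn[y yc /negPn gy]] := (gL _ dL, gL' _ dL).
move: xc yc gx gy; rewrite !mem_filter.
case/andP=> /mapP[{}x xc ->] _ /andP[/mapP[{}y yc ->] _] /negPf gx gy.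
by have := fc _ yc; have := fc _ xc; rewrite !inE !ffunE gx gy => /eqP <-.
Qed.

End Decide.

(** * Computable vertex lists for the graph operations *)

(* Unlike [enum 'I_n], this list reduces to explicit ordinals. *)
Fixpoint ords (n : nat) : seq 'I_n :=
  if n is m.+1 then ord0 :: map (lift ord0) (ords m) else [::].

Lemma covers_complete (n : nat) : covers (ords n : seq (complete n)).
Proof.
rewrite /covers /=; elim: n => [[]|n IHn i] //=; rewrite inE.
by case: (unliftP ord0 i) => [j ->|->]; rewrite ?eqxx // map_f ?orbT.
Qed.

Lemma covers_compl (G : sgraph) (s : seq G) :
  covers s -> covers (s : seq (compl G)).
Proof. by []. Qed.

Lemma covers_dunion (G H : sgraph) (s : seq G) (t : seq H) :
  covers s -> covers t -> covers (map inl s ++ map inr t : seq (dunion G H)).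
Proof.
move=> cs ct [x|y]; rewrite mem_cat; apply/orP; [left|right].
  exact: (map_f inl (cs x)).
exact: (map_f inr (ct y)).
Qed.

Lemma covers_join (G H : sgraph) (s : seq G) (t : seq H) :
  covers s -> covers t -> covers (map inl s ++ map inr t : seq (join G H)).
Proof. exact: covers_dunion. Qed.

Lemma covers_copies (k : nat) (G : sgraph) (s : seq G) :
  covers s -> covers ([seq (i, x) | i <- ords k, x <- s] : seq (copies k G)).
Proof.
by move=> cs [i x]; apply: (allpairs_f pair (covers_complete i) (cs x)).
Qed.

(** * The seven graphs *)

Theorem lemma1 :
  cograph_min_obstruction 2 (complete 5) /\
  cograph_min_obstruction 2 (compl (copies 3 (complete 3))) /\
  cograph_min_obstruction 2
    (join (copies 2 (complete 3)) (compl (complete 2))) /\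
  cograph_min_obstruction 2
    (join (copies 2 (compl (copies 2 (complete 2)))) (compl (complete 3))) /\
  cograph_min_obstruction 2
    (join (compl (copies 2 (complete 2))) (dunion (complete 1) (complete 2))) /\
  cograph_min_obstruction 2
    (join (dunion (compl (copies 2 (complete 2))) (complete 3))
          (compl (complete 2))) /\
  cograph_min_obstruction 2
    (compl (dunion (copies 3 (complete 2)) (complete 1))).
Proof.
have K := covers_complete; have nK k n := covers_copies (k := k) (K n).
have coK n := covers_compl (K n); have co2K2 := covers_compl (nK 2 2).
(* Each [covers] proof follows the construction of its graph and so supplies the explicit vertex
   list on which the test is evaluated. *)
split; first by apply: (min_obstructionP (K 5)); vm_compute.
split; first by apply: (min_obstructionP (covers_compl (nK 3 3))); vm_compute.
split.
  by apply: (min_obstructionP (covers_join (nK 2 3) (coK 2))); vm_compute.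
split.
  apply: (min_obstructionP (covers_join (covers_copies (k := 2) co2K2) (coK 3))).
  by vm_compute.
split.
  apply: (min_obstructionP (covers_join co2K2 (covers_dunion (K 1) (K 2)))).
  by vm_compute.
split.
  apply: (min_obstructionP
    (covers_join (covers_dunion co2K2 (K 3)) (coK 2))).
  by vm_compute.
apply: (min_obstructionP (covers_compl (covers_dunion (nK 3 2) (K 1)))).
by vm_compute.
Qed.
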